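(* Let $n \ge 1$ and let $m, r \ge 0$ be integers. Write $m = Mn + m_0$ and $r = Rn + r_0$ with integers $M, R \ge 0$ and $0 \le m_0, r_0 < n$. Then \[\sum_{d\mid n}\varphi\!\left(\frac{n}{d}\right)\sum_{j=-(d-1)}^{d-1}\ \sum_{\substack{\alpha\in\mathbb{N}^d\\ \|\alpha\|_d = R - j/d}}\binom{M}{\alpha_1}\cdots\binom{M}{\alpha_d}\binom{m_0}{r_0 + (n/d)j} \equiv 0 \pmod n,\] where the outer sum runs over the positive divisors $d$ of $n$ and $\varphi$ is Euler's totient function.
   Context: $\mathbb{N} = \{0,1,2,\dots\}$. For $\alpha = (\alpha_1,\dots,\alpha_d) \in \mathbb{N}^d$, the length is defined by $\|\alpha\|_d = \frac{1}{d}\sum_{i=1}^d \alpha_i$; the innermost sum is over all $\alpha\in\mathbb{N}^d$ with $\|\alpha\|_d = R - j/d$ (i.e. $\alpha_1+\cdots+\alpha_d = dR - j$). Binomial coefficients follow the convention $\binom{a}{b} = 0$ whenever $b > a$ or $b < 0$. *)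

(* Defs.v *)
From mathcomp Require Import all_boot all_order all_algebra.
From mathcomp Require Import zify.

Set Implicit Arguments.
Unset Strict Implicit.
Unset Printing Implicit Defensive.

Import Order.TTheory GRing.Theory Num.Theory.
Local Open Scope ring_scope.

(* [binz a b] extends ['C(a, b)] by 0 to negative b; ['C(a, b)] is already 0
   for b > a. *)
Definition binz (a : nat) (b : int) : nat :=
  if b is Posz k then 'C(a, k) else 0%N.

(* The integers -k, ..., k in increasing order. *)
Definition sym_range (k : nat) : seq int :=
  [seq i%:Z - k%:Z | i <- iota 0 (2 * k).+1].

Lemma mem_sym_range (k : nat) (j : int) :
  (j \in sym_range k) = (- k%:Z <= j <= k%:Z).
Proof.
apply/mapP/idP => [[i]|hj].
  by rewrite mem_iota => hi ->; lia.
by exists `|(j + k%:Z)%R|%N; [rewrite mem_iota|]; lia.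
Qed.

Lemma sym_range_uniq (k : nat) : uniq (sym_range k).
Proof. by rewrite map_inj_uniq ?iota_uniq // => x y; lia. Qed.

Definition multi_length (d : nat) (alpha : 'I_d -> nat) : rat :=
  (\sum_(i < d) alpha i)%:R / d%:R.

(* Multi-indices in N^d are represented by {ffun 'I_d -> 'I_(d * R + d)} when
   they are constrained to have length R - j/d with |j| <= d - 1. The bound on
   the entries loses nothing: *)
Lemma multi_length_bound (d R : nat) (j : int) (alpha : 'I_d -> nat) (i : 'I_d) :
  j \in sym_range d.-1 ->
  multi_length alpha = R%:R - j%:~R / d%:R ->
  (alpha i < d * R + d)%N.
Proof.
rewrite mem_sym_range /multi_length => hj hlen.
have d_gt0 : (0 < d)%N by apply: leq_ltn_trans (ltn_ord i).
have dN0 : d%:R != 0 :> rat by rewrite pnatr_eq0 -lt0n.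
have hsum : (\sum_(i < d) alpha i)%:Z = (d * R)%:Z - j.
  apply: (@intr_inj rat).
  move/(congr1 (fun x => x * d%:R)): hlen.
  by rewrite divfK // mulrBl divfK // rmorphB /= -!pmulrn natrM mulrC => ->; rewrite mulrC.
have : (alpha i <= \sum_(i < d) alpha i)%N by rewrite (bigD1 i) //= leq_addr.
lia.
Qed.

(* Main.v *)
(** By Vandermonde the sum over alpha is C(dM, dR - j), so with e = n/d the sum
    over j is the coefficient of x^r in (1 + x^e)^(dM) (1 + x)^(m0); as m0 < n,
    all indices j that contribute satisfy |j| < d. It remains to see that the
    polynomial sum_(d | n) phi(n/d) (1 + x^(n/d))^(dM) vanishes modulo n. This is
    Burnside's lemma for Z/n acting by translation on the subsets of
    Z/n x {1, ..., M} of given size: an element of order e acts with all orbits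
    of size e, so the sets it fixes are the unions of these nM/e orbits. *)
Require Import Defs.
From mathcomp Require Import all_boot all_order all_algebra.
From mathcomp Require Import all_fingroup cyclic zify.

Set Implicit Arguments.
Unset Strict Implicit.
Unset Printing Implicit Defensive.

(** * Unions of blocks of a partition *)

Lemma cover_subset_partition (T : finType) (P Q : {set {set T}}) (D B : {set T}) :
  partition P D -> Q \subset P -> B \in P -> (B \subset cover Q) = (B \in Q).
Proof.
case/and3P=> _ tiP P0 sQP PB; apply/idP/idP=> [sBQ|QB]; last first.
  by rewrite /cover (bigD1 B) //= subsetUl.
have [x Bx] : exists x, x \in B.
  by apply/set0Pn; apply: contraNneq P0 => <-.
(* [x] lies in some block [C] of [Q], and blocks of [P] that share a point coincide. *)
have /bigcupP[C QC Cx] := subsetP sBQ x Bx.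
by rewrite -(def_pblock tiP PB Bx) (def_pblock tiP (subsetP sQP C QC) Cx).
Qed.

Lemma card_cover_uniform (T : finType) (P Q : {set {set T}}) (D : {set T}) e :
    partition P D -> {in P, forall B : {set T}, #|B| = e} -> Q \subset P ->
  #|cover Q| = (#|Q| * e)%N.
Proof.
case/and3P=> _ tiP P0 uP sQP; apply: card_uniform_partition => [B QB|].
  exact: uP (subsetP sQP B QB).
apply/and3P; split=> //; first exact: trivIsetS tiP.
by apply: contra P0 => /(subsetP sQP).
Qed.

(** [cover] is injective on sets of blocks and multiplies cardinality by [e], so only the choices of
    s/e among the |D|/e blocks are counted. *)
Lemma card_unions_of_blocks (T : finType) (P : {set {set T}}) (D : {set T}) e s :
    partition P D -> {in P, forall B : {set T}, #|B| = e} -> (0 < e)%N ->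
  #|[set A in cover @: powerset P | #|A| == s]|
    = if (e %| s)%N then 'C(#|D| %/ e, s %/ e) else 0.
Proof.
move=> pP uP e0; rewrite (card_uniform_partition uP pP) mulnK //.
transitivity #|cover @: [set Q : {set {set T}} | Q \subset P & (#|Q| * e)%N == s]|.
  apply: eq_card => A; rewrite inE; apply/andP/imsetP=> [[/imsetP[Q]]|[Q]].
    rewrite powersetE => sQP -> /eqP sQ; exists Q => //.
    by rewrite inE sQP -(card_cover_uniform pP uP sQP) sQ eqxx.
  rewrite inE => /andP[sQP sQ] ->; rewrite (card_cover_uniform pP uP sQP).
  by split=> //; apply/imsetP; exists Q; rewrite ?powersetE.
rewrite card_in_imset => [|Q1 Q2]; last first.
  rewrite !inE => /andP[s1 _] /andP[s2 _] eqQ; apply/setP=> B.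
  have [PB|nPB] := boolP (B \in P).
    by rewrite -(cover_subset_partition pP s1) // eqQ (cover_subset_partition pP s2).
  have nQ (Q : {set {set T}}) : Q \subset P -> (B \in Q) = false.
    by move=> sQP; apply: contraNF nPB; apply/subsetP: B.
  by rewrite !nQ.
case: ifP => [/dvdnP[q ->]|nes].
  by rewrite mulnK // -cards_draws; apply: eq_card => Q; rewrite !inE eqn_pmul2r.
apply: eq_card0 => Q; rewrite inE; apply: contraFF nes => /andP[_ /eqP <-].
exact: dvdn_mull.
Qed.

(** * Burnside's lemma for translations, and its cyclic case *)

Section Burnside.
Local Open Scope group_scope.

(** The sets fixed by [a] are the unions of orbits of [<[a]>], and these orbits form a partition
    into blocks of size [#[a]]. *)
Lemma card_semiregular_fixed_sets (aT : finGroupType) (T : finType)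
    (to : {action aT &-> T}) (a : aT) s :
    (forall x, #|orbit to <[a]> x| = #[a]) ->
  #|[set A : {set T} | to^* A a == A & #|A| == s]|
    = if (#[a] %| s)%N then 'C(#|T| %/ #[a], s %/ #[a]) else 0.
Proof.
move=> reg; have pP : partition (orbit to <[a]> @: [set: T]) [set: T].
  by apply: orbit_partition; apply/actsP=> b _ x; rewrite !inE.
have uP : {in orbit to <[a]> @: [set: T], forall B : {set T}, #|B| = #[a]}.
  by move=> B /imsetP[x _ ->].
rewrite -cardsT -(card_unions_of_blocks s pP uP (order_gt0 a)).
apply: eq_card => A; rewrite !inE; congr (_ && _); apply/eqP/imsetP=> [fixA|].
  exists [set orbit to <[a]> x | x in A].
    by rewrite powersetE imsetS ?subsetT.
  have actA : [acts <[a]>, on A | to].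
    rewrite cycle_subG !inE; apply/subsetP=> x Ax.
    by rewrite inE -fixA mem_setact.
  by have /cover_partition := orbit_partition actA.
case=> Q; rewrite powersetE => /subsetP sQP ->; apply/eqP.
(* Acting by [a] preserves cardinality, so one inclusion suffices. *)
rewrite eqEcard card_setact leqnn andbT; apply/subsetP=> _ /imsetP[x cQx ->].
case/bigcupP: cQx => B QB Bx; apply/bigcupP; exists B => //.
case/imsetP: (sQP B QB) Bx => y _ ->.
by rewrite orbit_actr ?cycle_id.
Qed.

Definition translate (gT : finGroupType) (I : finType) (x : gT * I) (a : gT) :=
  (x.1 * a, x.2).

Lemma translate1 (gT : finGroupType) (I : finType) :
  right_id 1 (@translate gT I).
Proof. by case=> x i; rewrite /translate mulg1. Qed.

Lemma translateM (gT : finGroupType) (I : finType) (x : gT * I) :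
  act_morph (@translate gT I) x.
Proof. by move=> a b; rewrite /translate mulgA. Qed.

Canonical translate_action (gT : finGroupType) (I : finType) :=
  TotalAction (@translate1 gT I) (@translateM gT I).

Lemma card_orbit_translate (gT : finGroupType) (I : finType) (A : {set gT}) x :
  #|orbit (translate_action gT I) A x| = #|A|.
Proof.
by rewrite card_imset // => a b [/mulgI].
Qed.

(** The summand at [a] counts the [s]-subsets of [gT * 'I_M] fixed by [a]; by Burnside the sum is
    [#|gT|] times the number of orbits on [s]-subsets. *)
Lemma dvdn_sum_binomial_order (gT : finGroupType) M s :
  (#|gT| %| \sum_(a : gT)
     if #[a] %| s then 'C((#|gT| * M) %/ #[a], s %/ #[a]) else 0)%N.
Proof.
pose to := translate_action gT 'I_M; pose S := [set A : {set gT * 'I_M} | #|A| == s].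
have actS : [acts [set: gT], on S | to^*].
  by apply/actsP=> a _ A; rewrite !inE card_setact.
have := Frobenius_Cauchy actS; rewrite cardsT => eqB.
apply/dvdnP; exists #|orbit to^* [set: gT] @: S|; rewrite -eqB.
apply: eq_big => [a|a _]; first by rewrite inE.
have := @card_semiregular_fixed_sets _ _ to a s (fun x => card_orbit_translate _ x).
rewrite card_prod card_ord => <-.
by apply: eq_card => A; rewrite !inE sub1set inE andbC.
Qed.

(** The elements of order [e] are the generators of the unique subgroup of order [e] in [<[a]>],
    here generated by [b]. *)
Lemma card_order_cyclic (gT : finGroupType) (a : gT) e :
  (e %| #[a])%N -> #|[set x in <[a]> | #[x] == e]| = totient e.
Proof.
move=> ea; pose b := a ^+ (#[a] %/ e).
have ob : #[b] = e.
  by rewrite /b orderXdiv ?dvdn_div // divnA // mulKn ?order_gt0.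
rewrite -{2}ob totient_gen; apply: eq_card => x; rewrite !inE /generator.
have /setP/(_ <[x]>%G) := cycle_sub_group ea.
by rewrite !inE cycle_subG => ->; rewrite -val_eqE /= eq_sym.
Qed.

End Burnside.

Lemma dvdn_sum_totient_binomial n M s : (0 < n)%N ->
  (n %| \sum_(d <- divisors n) totient (n %/ d) *
     (if n %/ d %| s then 'C(d * M, s %/ (n %/ d)) else 0))%N.
Proof.
(* The additive group structure on ['I_n] requires [n] in successor form. *)
case: n => // n' _; set n := n'.+1.
have := @dvdn_sum_binomial_order 'I_n M s; rewrite card_ord.
have cyc (x : 'I_n) : x \in <[Zp1 : 'I_n]>%g by rewrite -Zp_cycle inE.
have on (x : 'I_n) : #[x]%g %| n by rewrite -[n in _ %| n]order_Zp1 order_dvdG.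
pose H d := if n %/ d %| s then 'C(d * M, s %/ (n %/ d)) else 0.
(* The elements of Z/n are grouped by their order n/d; each group has [totient (n %/ d)] members. *)
congr dvdn; transitivity (\sum_(d <- divisors n)
    \sum_(a : 'I_n | #[a]%g == n %/ d) H d); last first.
  rewrite !big_seq; apply: eq_bigr => d; rewrite -dvdn_divisors // => dn.
  rewrite sum_nat_const; congr (_ * _); rewrite -(@card_order_cyclic _ (Zp1 : 'I_n)).
    by apply: eq_card => x; rewrite !inE cyc.
  by rewrite order_Zp1 dvdn_div.
(* For fixed [a], the only divisor that contributes is d = n / [#[a]]. *)
rewrite (exchange_big_dep xpredT) //=; apply: eq_bigr => a _.
have oa := on a; have oaK : n %/ (n %/ #[a]%g) = #[a]%g by rewrite divnA // mulKn.
rewrite big_mkcond (bigD1_seq (n %/ #[a]%g)) ?divisors_uniq -?dvdn_divisors ?dvdn_div //=.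
rewrite oaK eqxx /H oaK big_seq_cond big1 ?addn0.
  by rewrite divn_mulAC.
move=> d; rewrite -dvdn_divisors // => /andP[dn nd]; case: eqP => // ed.
by case/negP: nd; rewrite ed divnA // mulKn.
Qed.

(** * Evaluation of the sums over multi-indices and over j *)

Import GRing.Theory Num.Theory Order.TTheory.
Local Open Scope ring_scope.

(** Truncating (1 + X)^M below degree [K] leaves the coefficients of degree below [K] in its powers
    unchanged. The truncation makes the exponents range over ['I_K], like the entries of [alpha]. *)
Lemma coef_truncated_binomial_exp (K M d s : nat) : (s < K)%N ->
  ((\poly_(k < K) ('C(M, k))%:R : {poly int}) ^+ d)`_s = ('C(d * M, s))%:R.
Proof.
elim: d s => [|d IHd] s sK; first by rewrite expr0 coef1 mul0n bin0n.
rewrite exprS coefM mulSn -binomial.Vandermonde natr_sum; apply: eq_bigr => j _.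
have jK : (j < K)%N by apply: leq_ltn_trans sK; rewrite -ltnS.
by rewrite coef_poly jK IHd ?natrM // (leq_ltn_trans _ sK) ?leq_subr.
Qed.

(** Expanding the [d]-th power of the truncated polynomial by distributivity gives one monomial per
    [alpha]; the coefficients of X^s are compared. *)
Lemma multiVandermonde (K M d s : nat) : (s < K)%N ->
  (\sum_(alpha : {ffun 'I_d -> 'I_K} | \sum_(i < d) alpha i == s)
     \prod_(i < d) 'C(M, alpha i))%N = 'C(d * M, s).
Proof.
move=> sK; apply/eqP; rewrite -(eqr_nat int) -(coef_truncated_binomial_exp _ _ sK).
rewrite -[d in _ ^+ d]card_ord -prodr_const poly_def.
rewrite (bigA_distr_bigA (fun (i : 'I_d) (k : 'I_K) => ('C(M, k))%:R *: 'X^k)) coef_sum.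
rewrite natr_sum big_mkcond /=; apply/eqP; apply: eq_bigr => alpha _.
have -> : \prod_(i < d) (('C(M, alpha i))%:R *: 'X^(alpha i))
    = (\prod_(i < d) 'C(M, alpha i))%N%:R *: 'X^(\sum_(i < d) alpha i)%N :> {poly int}.
  by rewrite scaler_prod -prodrXr natr_prod.
by rewrite coefZ coefXn eq_sym; case: ifP => _; rewrite ?mulr1 ?mulr0.
Qed.

Lemma multi_length_eq (d R : nat) (j : int) (alpha : 'I_d -> nat) : (0 < d)%N ->
  (multi_length alpha == R%:R - j%:~R / d%:R)
    = ((\sum_(i < d) alpha i)%N%:Z == (d * R)%:Z - j).
Proof.
move=> d_gt0; have dN0 : d%:R != 0 :> rat by rewrite pnatr_eq0 -lt0n.
rewrite /multi_length -(eqr_int rat) -(inj_eq (mulIf dN0)) divfK // mulrBl divfK //.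
by rewrite rmorphB /= -!pmulrn natrM [d%:R * _]mulrC.
Qed.

Lemma sum_multi_length (d M R : nat) (j : int) : (0 < d)%N -> j \in sym_range d.-1 ->
  (\sum_(alpha : {ffun 'I_d -> 'I_(d * R + d)}
       | multi_length (fun i => alpha i : nat) == (R%:R - j%:~R / d%:R)%R)
     \prod_(i < d) 'C(M, alpha i))%N = binz (d * M) ((d * R)%:Z - j).
Proof.
move=> d_gt0; rewrite mem_sym_range => jd.
under eq_bigl => alpha do rewrite multi_length_eq //.
(* If dR - j = s is nonnegative, then |j| < d gives s < dR + d, as the bound on the entries
   requires; if it is negative, both sides are 0. *)
case E: (_ - j) => [s|s].
  by rewrite /= -(@multiVandermonde (d * R + d)) //; lia.
by rewrite big_pred0.
Qed.

(** The substitution t = r0 + e j gives r - t = e (dR - j). The bound t <= r keeps the natural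
    subtraction exact. *)
Lemma sum_sym_range_binz (d e M R m0 r0 : nat) : (m0 < d * e)%N -> (r0 < d * e)%N ->
  (\sum_(j <- sym_range d.-1)
     binz (d * M) ((d * R)%:Z - j)%R * binz m0 (r0%:Z + e%:Z * j)%R
   = \sum_(t < (minn m0 (R * (d * e) + r0)).+1)
       (if e %| (R * (d * e) + r0) - t
        then 'C(d * M, ((R * (d * e) + r0) - t) %/ e) else 0) * 'C(m0, t))%N.
Proof.
move=> m0n r0n; set r := (R * (d * e) + r0)%N.
have [d0 e0] : (0 < d)%N /\ (0 < e)%N by apply/andP; rewrite -muln_gt0; lia.
pose G (j : int) := (binz (d * M) ((d * R)%:Z - j)%R * binz m0 (r0%:Z + e%:Z * j)%R)%N.
pose N := (minn m0 r).+1.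
(* The double sum over the pairs with t = r0 + e j is evaluated in both orders: each j meets at most
   one t, and each t at most one j. *)
transitivity (\sum_(j <- sym_range d.-1) \sum_(t < N)
    if t%:Z == (r0%:Z + e%:Z * j)%R then G j else 0)%N.
  apply: eq_bigr => j _; rewrite -/(G j) -big_mkcond /=.
  have [Nt|] := boolP [exists t : 'I_N, t%:Z == (r0%:Z + e%:Z * j)%R].
    have [t /eqP Et] := existsP Nt; rewrite (big_pred1 t) // => u.
    by rewrite /= -Et eqz_nat.
  (* If r0 + e j is no admissible t, it is negative, exceeds [m0], or exceeds [r] and so makes dR -
     j negative; in each case [G j] is 0. *)
  rewrite negb_exists => /forallP nt; rewrite big1 => [|t]; last by rewrite (negPf (nt t)).
  rewrite /G; case E: (r0%:Z + _) => [k|k] /=; last by rewrite muln0.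
  have [km0|?] := leqP k m0; last by rewrite bin_small ?muln0.
  have [kr|rk] := leqP k r.
    have kN : (k < N)%N by rewrite ltnS leq_min km0.
    by have := nt (Ordinal kN); rewrite /= E eqxx.
  case F: (_ - j) => [i|//]; suff : (k <= r)%N by rewrite leqNgt rk.
  suff : k%:Z + e%:Z * i%:Z = r%:Z by lia.
  by rewrite -F -E /r; nia.
rewrite exchange_big /=; apply: eq_bigr => t _; rewrite -big_mkcond /=.
have /andP[tm0 tr] : (t <= m0)%N && (t <= r)%N by rewrite -leq_min -ltnS.
have [/dvdnP[q Eq]|nq] := boolP (e %| r - t)%N; last first.
  rewrite mul0n big1 // => j /eqP Ej; rewrite /G.
  case F: (_ - j) => [i|//]; case/negP: nq; apply/dvdnP; exists i.
  suff : t%:Z + e%:Z * i%:Z = r%:Z by nia.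
  by rewrite Ej -F /r; nia.
pose j := (d * R)%:Z - q%:Z.
have Ej : t%:Z = r0%:Z + e%:Z * j.
  have : t%:Z + e%:Z * q%:Z = r%:Z by nia.
  by rewrite /j /r; nia.
(* Both t <= m0 and [r0] lie in [0, de), so e |j| = |t - r0| < de. *)
have jd : j \in sym_range d.-1.
  by rewrite mem_sym_range; nia.
rewrite big_mkcond (bigD1_seq j) ?sym_range_uniq //= -Ej eqxx big1 => [|i nij]; last first.
  rewrite Ej; case: eqP => // /addrI /mulfI eij; case/eqP: nij; rewrite eij //; lia.
by rewrite addn0 /G -Ej /j opprB addrC subrK Eq mulnK.
Qed.

Theorem theorem3 (n m r M R m0 r0 : nat)
    (hn : (1 <= n)%N)
    (hm : m = (M * n + m0)%N) (hm0 : (m0 < n)%N)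
    (hr : r = (R * n + r0)%N) (hr0 : (r0 < n)%N) :
  (\sum_(d <- divisors n)
      totient (n %/ d) *
      \sum_(j <- sym_range d.-1)
        \sum_(alpha : {ffun 'I_d -> 'I_(d * R + d)}
              | multi_length (fun i => alpha i : nat)
                  == (R%:R - j%:~R / d%:R)%R)
          (\prod_(i < d) 'C(M, alpha i)) *
          binz m0 (r0%:Z + (n %/ d)%:Z * j)%R
   = 0 %[mod n])%N.
Proof.
apply/eqP; rewrite mod0n -/(dvdn _ _).
pose F d s := if (n %/ d %| s)%N then 'C(d * M, s %/ (n %/ d)) else 0%N.
(* Collected by t, the factor of each ['C(m0, t)] is the Burnside sum for subsets of size r - t,
   hence divisible by [n]. *)
suff -> : (\sum_(d <- divisors n) totient (n %/ d) *
      \sum_(j <- sym_range d.-1)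
        \sum_(alpha : {ffun 'I_d -> 'I_(d * R + d)}
              | multi_length (fun i => alpha i : nat)
                  == (R%:R - j%:~R / d%:R)%R)
          (\prod_(i < d) 'C(M, alpha i)) * binz m0 (r0%:Z + (n %/ d)%:Z * j)%R
    = \sum_(t < (minn m0 r).+1)
        (\sum_(d <- divisors n) totient (n %/ d) * F d (r - t)) * 'C(m0, t))%N.
  by apply: dvdn_sum => t _; rewrite dvdn_mulr // dvdn_sum_totient_binomial.
under [RHS]eq_bigr do rewrite big_distrl.
rewrite exchange_big /= !big_seq; apply: eq_bigr => d; rewrite -dvdn_divisors // => dn.
have d0 := dvdn_gt0 hn dn; have Edn : (d * (n %/ d) = n)%N by rewrite mulnC divnK.
under [RHS]eq_bigr do rewrite -mulnA.
rewrite -big_distrr /=; congr (_ * _)%N.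
have := @sum_sym_range_binz d (n %/ d) M R m0 r0; rewrite Edn -hr => /(_ hm0 hr0) <-.
rewrite !big_seq; apply: eq_bigr => j jd.
by rewrite -big_distrl sum_multi_length.
Qed.
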